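(* Let $m,n\ge 1$ be integers, let $\mathbf{X}_n=(X_1,\dots,X_n)$ and $\mathbf{X}'_m=(X'_1,\dots,X'_m)$ be families of points of $\mathbb{R}^d$, and for $k\in\{1,\dots,m\}$ let the $k$-NN vector of weights $\mathbf{w}^{(k)}_m=(w^{(k)}_1,\dots,w^{(k)}_m)$ be defined by $$w^{(k)}_j:=\frac{m}{kn}\sum_{i=1}^n\sum_{l=1}^k \mathbf{1}_{\{j=j^{(l)}_i\}},\qquad j\in\{1,\dots,m\}.$$ Then, for every $k\in\{1,\dots,m\}$, the vector $\mathbf{w}^{(k)}_m$ satisfies $w^{(k)}_j\ge 0$ for all $j$ and $\sum_{j=1}^m w^{(k)}_j=m$, and for all $q\in[1,+\infty)$, $$W_q^q\left(\hat{\mu}_{\mathbf{X}_n},\hat{\mu}_{\mathbf{X}'_m}^{\mathbf{w}^{(k)}_m}\right)\le \frac{1}{kn}\sum_{i=1}^n\sum_{l=1}^k\left|X_i-\mathrm{NN}^{(l)}_{\mathbf{X}'_m}(X_i)\right|^q.$$ For $k=1$ equality holds: $$W_q^q\left(\hat{\mu}_{\mathbf{X}_n},\hat{\mu}_{\mathbf{X}'_m}^{\mathbf{w}^{(1)}_m}\right)=\frac1n\sum_{i=1}^n\left|X_i-\mathrm{NN}^{(1)}_{\mathbf{X}'_m}(X_i)\right|^q,$$ and $\mathbf{w}^{(1)}_m$ is optimal in the sense that for any $\mathbf{w}_m=(w_1,\dots,w_m)$ with $w_j\ge 0$ for all $j$ and $\sum_{j=1}^m w_j=m$, one has $$W_q\left(\hat{\mu}_{\mathbf{X}_n},\hat{\mu}_{\mathbf{X}'_m}^{\mathbf{w}^{(1)}_m}\right)\le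 W_q\left(\hat{\mu}_{\mathbf{X}_n},\hat{\mu}_{\mathbf{X}'_m}^{\mathbf{w}_m}\right).$$
   Context: $|\cdot|$ is a fixed norm on $\mathbb{R}^d$ (not necessarily Euclidean). For $q\in[1,+\infty)$ and probability measures $\mu,\nu$ on $\mathbb{R}^d$ with finite $q$-th moments, the Wasserstein distance is $W_q(\mu,\nu)=\inf\{\int|x-x'|^q\,d\gamma(x,x'):\gamma\in\Pi(\mu,\nu)\}^{1/q}$, where $\Pi(\mu,\nu)$ is the set of probability measures on $\mathbb{R}^d\times\mathbb{R}^d$ with marginals $\mu$ and $\nu$. Empirical measures: $\hat{\mu}_{\mathbf{X}_n}:=\frac1n\sum_{i=1}^n\delta_{X_i}$, and for $\mathbf{w}_m=(w_1,\dots,w_m)$ with nonnegative entries summing to $m$, $\hat{\mu}_{\mathbf{X}'_m}^{\mathbf{w}_m}:=\frac1m\sum_{j=1}^m w_j\delta_{X'_j}$. Nearest neighbors: for $x\in\mathbb{R}^d$, order the indices $1,\dots,m$ by increasing distance $|x-X'_j|$, ties being broken by lowest index; $j^{(l)}(x)$ denotes the $l$-th index in this order (so $(j^{(l)}(x))_{1\le l\le m}$ is a permutation of $\{1,\dots,m\}$) and $\mathrm{NN}^{(l)}_{\mathbf{X}'_m}(x):=X'_{j^{(l)}(x)}$ is the $l$-th nearest neighbor of $x$ among $\mathbf{X}'_m$. We write $j^{(l)}_i:=j^{(l)}(X_i)$. *)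

(* Defs.v *)
From HB Require Import structures.
From mathcomp Require Import all_boot all_order all_algebra.
From mathcomp Require Import all_classical all_reals all_analysis.
Set Implicit Arguments.
Unset Strict Implicit.
Unset Printing Implicit Defensive.
Import Order.TTheory GRing.Theory Num.Theory.
Import numFieldNormedType.Exports.

Local Open Scope classical_set_scope.
Local Open Scope ring_scope.

(* 'rV[R]_d already carries the sup norm canonically, hence an arbitrary norm
   is a separate function N. *)
Record is_norm (R : realType) (d : nat) (N : 'rV[R]_d -> R) : Prop := IsNorm {
  norm_definite : forall x, N x = 0 -> x = 0 ;
  norm_homogeneous : forall (a : R) x, N (a *: x) = `|a| * N x ;
  norm_triangle : forall x y, N (x + y) <= N x + N y
}.

(* R^d with its Borel sigma-algebra. The canonical topology of 'rV[R]_d is the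
   one induced by any norm. *)
Definition borel_rV (R : realType) (d : nat) :=
  g_sigma_algebraType (@open 'rV[R]_d).

Section wasserstein.
Context {R : realType} {d : nat}.
Implicit Types mu nu : probability (borel_rV R d) R.

Definition is_coupling mu nu
    (gamma : probability (borel_rV R d * borel_rV R d)%type R) : Prop :=
  forall A : set (borel_rV R d), measurable A ->
    gamma (fst @^-1` A) = mu A /\ gamma (snd @^-1` A) = nu A.

Definition transport_cost (N : 'rV[R]_d -> R) (q : R)
    (gamma : probability (borel_rV R d * borel_rV R d)%type R) : \bar R :=
  (\int[gamma]_z (N ((z.1 : 'rV[R]_d) - (z.2 : 'rV[R]_d)) `^ q)%:E)%E.

Definition wasserstein (N : 'rV[R]_d -> R) (q : R) mu nu : \bar R :=
  ((ereal_inf [set transport_cost N q gamma | gamma in is_coupling mu nu])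
     `^ q^-1)%E.

End wasserstein.

Definition is_weights (R : realType) (m : nat) (w : 'I_m -> R) : Prop :=
  (forall j, 0 <= w j) /\ \sum_(j < m) w j = m%:R.

Section empirical.
Local Open Scope ereal_scope.
Context {R : realType} {d : nat}.

Definition empirical_fun n (X : 'I_n -> 'rV[R]_d) (A : set (borel_rV R d)) :
    \bar R :=
  (n%:R^-1)%:E * \sum_(i < n) \d_(X i : borel_rV R d) A.

Definition wempirical_fun m (w : 'I_m -> R) (X' : 'I_m -> 'rV[R]_d)
    (A : set (borel_rV R d)) : \bar R :=
  (m%:R^-1)%:E * \sum_(j < m) (w j)%:E * \d_(X' j : borel_rV R d) A.

(* The unused proof arguments of wempirical and empirical make the instances of
   probability below available for inference. *)
Section wempirical.
Context m (w : 'I_m -> R) (X' : 'I_m -> 'rV[R]_d).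
Hypotheses (hm : (0 < m)%N) (hw : is_weights w).

Lemma wempirical_fun0 : wempirical_fun w X' set0 = 0.
Proof. by rewrite /wempirical_fun big1 ?mule0// => j _; rewrite measure0 mule0. Qed.

Lemma wempirical_fun_ge0 A : 0 <= wempirical_fun w X' A.
Proof.
rewrite mule_ge0 ?lee_fin ?invr_ge0//; apply: sume_ge0 => j _.
by rewrite mule_ge0 ?lee_fin//; exact: hw.1.
Qed.

Lemma wempirical_fun_sigma_additive : semi_sigma_additive (wempirical_fun w X').
Proof.
pose dirs (j : 'I_m) : {measure set (borel_rV R d) -> \bar R} :=
  mscale (NngNum (hw.1 j)) (\d_(X' j : borel_rV R d)).
pose mus (i : nat) : {measure set (borel_rV R d) -> \bar R} :=
  if insub i is Some j then dirs j else mzero.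
have c0 : (0 <= m%:R^-1 :> R)%R by rewrite invr_ge0.
have -> : wempirical_fun w X' = mscale (NngNum c0) (msum mus m).
  apply/funext => A; rewrite /wempirical_fun /mscale /msum /=; congr (_ * _).
  by apply: eq_bigr => j _; rewrite /mus valK.
exact: measure_semi_sigma_additive.
Qed.

Lemma wempirical_funT : wempirical_fun w X' setT = 1.
Proof.
rewrite /wempirical_fun; under eq_bigr do rewrite diracT mule1.
rewrite sumEFin hw.2 -EFinM mulVf// pnatr_eq0 -lt0n; exact: hm.
Qed.

Definition wempirical of (0 < m)%N & is_weights w : set (borel_rV R d) -> \bar R :=
  wempirical_fun w X'.

HB.instance Definition _ := isMeasure.Build _ _ _ (wempirical hm hw)
  wempirical_fun0 wempirical_fun_ge0 wempirical_fun_sigma_additive.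

HB.instance Definition _ :=
  Measure_isProbability.Build _ _ _ (wempirical hm hw) wempirical_funT.

End wempirical.

Section unweighted.
Context n (X : 'I_n -> 'rV[R]_d).
Hypothesis hn : (0 < n)%N.

Lemma is_weights1 : is_weights (fun _ : 'I_n => 1%R : R).
Proof. by split => //; rewrite sumr_const card_ord. Qed.

Lemma empirical_funE : empirical_fun X = wempirical_fun (fun=> 1%R) X.
Proof.
apply/funext => A; rewrite /empirical_fun /wempirical_fun; congr (_ * _).
by apply: eq_bigr => i _; rewrite mul1e.
Qed.

Lemma empirical_fun0 : empirical_fun X set0 = 0.
Proof. by rewrite empirical_funE wempirical_fun0. Qed.

Lemma empirical_fun_ge0 A : 0 <= empirical_fun X A.
Proof. by rewrite empirical_funE wempirical_fun_ge0//; exact: is_weights1. Qed.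

Lemma empirical_fun_sigma_additive : semi_sigma_additive (empirical_fun X).
Proof.
rewrite empirical_funE; apply: wempirical_fun_sigma_additive.
exact: is_weights1.
Qed.

Lemma empirical_funT : empirical_fun X setT = 1.
Proof. by rewrite empirical_funE wempirical_funT//; exact: is_weights1. Qed.

Definition empirical of (0 < n)%N : set (borel_rV R d) -> \bar R :=
  empirical_fun X.

HB.instance Definition _ := isMeasure.Build _ _ _ (empirical hn)
  empirical_fun0 empirical_fun_ge0 empirical_fun_sigma_additive.

HB.instance Definition _ :=
  Measure_isProbability.Build _ _ _ (empirical hn) empirical_funT.

End unweighted.

End empirical.

Section nearest_neighbors.
Context {R : realType} {d : nat} (N : 'rV[R]_d -> R).
Context {m : nat} (X' : 'I_m -> 'rV[R]_d).

Definition nn_le (x : 'rV[R]_d) : rel 'I_m := fun i j =>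
  (N (x - X' i) < N (x - X' j)) ||
  ((N (x - X' i) == N (x - X' j)) && (i <= j)%N).

(* Ranks are counted from 0: nn_index x l is j^(l+1)(x). *)
Definition nn_index (x : 'rV[R]_d) (l : 'I_m) : 'I_m :=
  tnth (sort_tuple (nn_le x) (ord_tuple m)) l.

Definition nn (x : 'rV[R]_d) (l : 'I_m) : 'rV[R]_d := X' (nn_index x l).

Definition knn_weights {n : nat} (X : 'I_n -> 'rV[R]_d) (k : nat) (j : 'I_m) : R :=
  m%:R / (k%:R * n%:R) *
  \sum_(i < n) \sum_(l < m | (l < k)%N) (j == nn_index (X i) l)%:R.

End nearest_neighbors.

(* Main.v *)
(** The plan that sends mass [1/(kn)] from each [X_i] to each of its [k] nearest
    neighbours couples the two measures, and its cost is the right-hand side of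
    the upper bound. Conversely, a coupling with any reweighted measure is
    carried by points [(x, X'_j)], whose cost is at least the one from [x] to
    its nearest neighbour, a function of [x] alone whose integral depends only
    on the first marginal. *)

Require Import Defs.
From HB Require Import structures.
From mathcomp Require Import all_boot all_order all_algebra.
From mathcomp Require Import all_classical all_reals all_analysis.
From mathcomp Require Import measurable_realfun.
Import Order.TTheory GRing.Theory Num.Theory.
Import numFieldNormedType.Exports.
Import HBNNSimple.
Local Open Scope ring_scope.

(** * Integration against finitely supported measures *)

Section atomic_measures.
Local Open Scope classical_set_scope.
Local Open Scope ereal_scope.
Context {disp : measure_display} {T : measurableType disp} {R : realType}.
Implicit Types (mu : {measure set T -> \bar R}) (f g : T -> \bar R).

(** Both integrals are suprema over simple functions below the integrand, and a simple function
    below [f] is also below [g]. This suits transport costs, whose measurability is never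
    established. *)
Lemma ge0_le_lower_integral mu f g : (forall x, 0 <= f x) ->
  (forall x, f x <= g x) -> \int[mu]_x f x <= \int[mu]_x g x.
Proof.
move=> f0 fg; rewrite !ge0_integralTE//; last first.
  by move=> x; exact: le_trans (fg x).
apply: le_ereal_sup => _ [h hf <-]; exists h => // x /=.
exact: le_trans (fg x).
Qed.

Section atoms.
Context {I : finType} (w : I -> R) (w0 : forall i, (0 <= w i)%R) (z : I -> T).

(** [msum] sums a sequence indexed by [nat], so [I] is enumerated and the sequence is continued by
    the zero measure. *)
Definition atom_seq (i : nat) : {measure set T -> \bar R} :=
  if insub i is Some j then
    mscale (NngNum (w0 (enum_val (j : 'I_#|I|)))) \d_(z (enum_val j))
  else mzero.

Lemma msum_atom_seq A :
  msum atom_seq #|I| A = \sum_i (w i)%:E * \d_(z i) A.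
Proof.
rewrite /msum [RHS](reindex _ (onW_bij _ (@enum_val_bij I)))/=.
by apply: eq_bigr => j _; rewrite /atom_seq valK.
Qed.

Lemma atomic_probability : (\sum_i w i)%R = 1%R ->
  exists P : probability T R,
    forall A, P A = \sum_i (w i)%:E * \d_(z i) A.
Proof.
move=> w1; have mT : msum atom_seq #|I| setT = 1.
  rewrite msum_atom_seq; under eq_bigr do rewrite diracT mule1.
  by rewrite sumEFin w1.
pose isP := Measure_isProbability.Build _ _ _ (msum atom_seq #|I|) mT.
pose P : probability T R := HB.pack (msum atom_seq #|I|) isP.
by exists P; exact: msum_atom_seq.
Qed.

Context mu (mu_atoms : forall A, measurable A ->
  mu A = \sum_i (w i)%:E * \d_(z i) A).

Lemma ge0_integral_atoms f : (forall x, 0 <= f x) ->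
  measurable_fun [set: T] f -> \int[mu]_x f x = \sum_i (w i)%:E * f (z i).
Proof.
move=> f0 mf; rewrite (eq_measure_integral (msum atom_seq #|I|)); last first.
  by move=> A mA _; rewrite mu_atoms// -msum_atom_seq.
rewrite ge0_integral_measure_sum//.
rewrite [RHS](reindex _ (onW_bij _ (@enum_val_bij I)))/=.
apply: eq_bigr => j _; rewrite /atom_seq valK.
by rewrite ge0_integral_mscale// integral_dirac// diracT mul1e.
Qed.

(* No measurability of f: the integral of a nonnegative function is defined as
   a supremum over the simple functions below it. *)
Lemma integral_atoms_le f : (forall x, 0 <= f x) ->
  \int[mu]_x f x <= \sum_i (w i)%:E * f (z i).
Proof.
move=> f0; rewrite ge0_integralTE//; apply: ge_ereal_sup => _ [h hf <-].
(* The simple function [h] is measurable, so its integral is the finite sum of its values at the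
   atoms, and [h] is below [f] at each of them. *)
rewrite -integralT_nnsfun ge0_integral_atoms.
- by apply: lee_sum => i _; rewrite lee_wpmul2l// lee_fin.
- by move=> x; rewrite lee_fin.
- exact/measurable_EFinP.
Qed.

End atoms.

Lemma measurable_fun_finite_support (s : set T) f :
  (forall x, measurable [set x : T]) -> finite_set s ->
  (forall x, ~ s x -> f x = 0) -> measurable_fun [set: T] f.
Proof.
move=> m1 fs f0 _ B mB; rewrite setTI.
have mfin (A : set T) : finite_set A -> measurable A.
  by move=> fA; apply: countable_measurable => //; exact: finite_set_countable.
(* Off [s] the only value is 0, so the preimage is a finite set together with either all of the
   complement of [s] or nothing. *)
have -> : f @^-1` B = (s `&` f @^-1` B) `|` (~` s `&` [set x | B 0]).
  apply/seteqP; split=> x /=.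
    have [sx Bfx|sx] := pselect (s x); first by left.
    by rewrite (f0 _ sx) => B0; right.
  by move=> [[]//|[sx]]; rewrite (f0 _ sx).
apply: measurableU.
  by apply: mfin; apply: sub_finite_set fs; exact: subIsetl.
apply: measurableI; first by apply: measurableC; exact: mfin.
have [B0|B0] := pselect (B 0).
  by rewrite (_ : [set _ | _] = setT)//; apply/seteqP; split.
by rewrite (_ : [set _ | _] = set0)//; apply/seteqP; split.
Qed.

End atomic_measures.

(** * Wasserstein costs and a lower bound valid for all couplings *)

Section wasserstein_theory.
Local Open Scope classical_set_scope.
Local Open Scope ereal_scope.
Context {R : realType} {d : nat} (N : 'rV[R]_d -> R).

Lemma measurable_set1_borel (x : borel_rV R d) : measurable [set x].
Proof.
rewrite -(setCK [set x]); apply: measurableC; apply: sub_sigma_algebra.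
apply: closed_openC; apply: (@accessible_closed_set1 'rV[R]_d).
exact/hausdorff_accessible/norm_hausdorff.
Qed.

Lemma inf_transport_cost_ge0 (q : R) (mu nu : probability (borel_rV R d) R) :
  0 <= ereal_inf [set transport_cost N q gamma | gamma in is_coupling mu nu].
Proof.
apply: le_ereal_inf_tmp => _ [gamma _ <-].
by apply: integral_ge0 => z _; rewrite lee_fin powR_ge0.
Qed.

(** The powers [q^-1] and [q] cancel because [q] is nonzero and the infimum is nonnegative. *)
Lemma wasserstein_poweR (q : R) (mu nu : probability (borel_rV R d) R) :
  (1 <= q)%R -> wasserstein N q mu nu `^ q =
  ereal_inf [set transport_cost N q gamma | gamma in is_coupling mu nu].
Proof.
move=> q1; rewrite /wasserstein -poweRrM mulVf.
  by rewrite poweRe1// inf_transport_cost_ge0.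
by rewrite gt_eqF// (lt_le_trans ltr01).
Qed.

Context {n m : nat} (hn : (0 < n)%N) (hm : (0 < m)%N).
Context (X : 'I_n -> 'rV[R]_d) (X' : 'I_m -> 'rV[R]_d).

Lemma ge0_integral_empirical (f : borel_rV R d -> \bar R) :
  (forall x, 0 <= f x) -> measurable_fun [set: borel_rV R d] f ->
  \int[empirical X hn]_x f x = \sum_(i < n) (n%:R^-1)%:E * f (X i).
Proof.
move=> f0 mf; have n0 (i : 'I_n) : (0 <= n%:R^-1 :> R)%R by rewrite invr_ge0.
apply: (@ge0_integral_atoms _ (borel_rV R d) _ _ _ n0) => // A _.
by rewrite -ge0_sume_distrr.
Qed.

(* The function h in the proof is measurable even if c is not, because it
   vanishes off a finite set. *)
Lemma coupling_integral_ge (w : 'I_m -> R) (hw : is_weights w)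
    (gamma : probability (borel_rV R d * borel_rV R d)%type R)
    (f : 'rV[R]_d * 'rV[R]_d -> \bar R) (c : 'rV[R]_d -> R) :
  is_coupling (empirical X hn) (wempirical X' hm hw) gamma ->
  (forall z, 0 <= f z) -> (forall x, (0 <= c x)%R) ->
  (forall i j, (c (X i))%:E <= f (X i, X' j)) ->
  (n%:R^-1 * \sum_(i < n) c (X i))%:E <= \int[gamma]_z f z.
Proof.
move=> cpl f0 c0 cf.
(* The bound [cf] controls [f] only at the pairs [(X i, X' j)], so [c] is cut off to the sample
   points in both variables to get [g] below [f] everywhere. *)
pose h (x : borel_rV R d) : \bar R := (\1_(range X) x * c x)%:E.
pose g (z : borel_rV R d * borel_rV R d) : \bar R :=
  h z.1 * (\1_(range X') z.2)%:E.
have h0 x : 0 <= h x by rewrite lee_fin mulr_ge0.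
have g0 z : 0 <= g z by rewrite mule_ge0.
have finX : finite_set (range X) by exact: finite_image.
have mX' : measurable (range X' : set (borel_rV R d)).
  apply: countable_measurable; first exact: measurable_set1_borel.
  by apply: finite_set_countable; exact: finite_image.
have mh : measurable_fun [set: borel_rV R d] h.
  apply: (@measurable_fun_finite_support _ (borel_rV R d) _ (range X)) => //.
    exact: measurable_set1_borel.
  by move=> x Xx; rewrite /h indicE memNset// mul0r.
have mh1 : measurable_fun [set: borel_rV R d * borel_rV R d] (h \o fst).
  by apply: measurableT_comp => //; exact: measurable_fst.
have mg : measurable_fun [set: borel_rV R d * borel_rV R d] g.
  apply: emeasurable_funM => //; apply/measurable_EFinP.
  apply: measurableT_comp; last exact: measurable_snd.
  exact: measurable_indic.
apply: (@le_trans _ _ (\int[gamma]_z g z)); last first.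
  apply: ge0_le_lower_integral => // -[x y].
  rewrite /g /h /= !indicE.
  have [/set_mem[i _ <-]|_] := boolP (x \in _); last by rewrite mul0r mul0e.
  have [/set_mem[j _ <-]|_] := boolP (y \in _); last by rewrite mule0.
  by rewrite mul1r mule1.
(* The two integrands differ only where the second coordinate misses [range X'], a null set because
   the second marginal is carried by [range X']. *)
have -> : \int[gamma]_z g z = \int[gamma]_z (h \o fst) z.
  apply: ge0_ae_eq_integral => //; first by move=> z _; exact: h0.
  exists (snd @^-1` ~` (range X' : set (borel_rV R d))); split.
  - rewrite -[X in measurable X]setTI; apply: measurable_snd => //.
    exact: measurableC.
  - apply: (eq_trans (cpl _ _).2); first exact: measurableC.
    change (wempirical_fun w X' (~` range X') = 0).
    rewrite /wempirical_fun big1 ?mule0// => j _.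
    by rewrite diracE memNset ?mule0// => /(_ (imageP _ I)).
  - move=> [x y] /= H; apply: contra_not H => X'y _.
    by rewrite /g indicE mem_set// mule1.
(* Only the first coordinate remains, so the integral is taken against the first marginal, which is
   the empirical measure. *)
rewrite -(@ge0_integral_pushforward _ _ _ _ _ _ measurable_fst gamma setT)//.
rewrite (eq_measure_integral (empirical X hn)); last first.
  by move=> A mA _; exact: (cpl _ mA).1.
rewrite ge0_integral_empirical// mulr_sumr -sumEFin lee_sum// => i _.
by rewrite /h indicE mem_set// mul1r -EFinM.
Qed.

End wasserstein_theory.

(** * Nearest neighbours, their weights and the associated plan *)

Section nearest_neighbors_theory.
Local Open Scope classical_set_scope.
Context {R : realType} {d : nat} (N : 'rV[R]_d -> R).

Lemma is_norm_ge0 : is_norm N -> forall x, 0 <= N x.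
Proof.
move=> hN x; have N0 : N 0 = 0.
  by rewrite -(scale0r (0 : 'rV[R]_d)) norm_homogeneous// normr0 mul0r.
(* The triangle inequality for [x] and [- x] reads [0 <= 2 N x]. *)
have := norm_triangle hN x (- x).
rewrite subrr N0 -scaleN1r norm_homogeneous// normrN1 mul1r -mulr2n.
by rewrite pmulrn_lge0.
Qed.

Context {m n : nat} (hm : (0 < m)%N) (hn : (0 < n)%N).
Context (X : 'I_n -> 'rV[R]_d) (X' : 'I_m -> 'rV[R]_d).

Lemma nn_le_total x : total (nn_le N X' x).
Proof. by move=> i j; rewrite /nn_le; case: ltgtP => //= _; exact: leq_total. Qed.

Lemma nn_le_trans x : transitive (nn_le N X' x).
Proof.
move=> j i l; rewrite /nn_le => /orP[ij|/andP[/eqP -> ij]].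
  by move=> /orP[jl|/andP[/eqP <- _]]; rewrite ?ij// (lt_trans ij jl).
by move=> /orP[->//|/andP[-> jl]]; rewrite (leq_trans ij jl) orbT.
Qed.

(** Rank 0 is the head of a list sorted by a total transitive relation, so it precedes every index;
    [nn_le] compares distances first. *)
Lemma nn0_le x j : N (x - nn N X' x (Ordinal hm)) <= N (x - X' j).
Proof.
rewrite /nn /nn_index (tnth_nth j)/=.
have := sort_sorted (nn_le_total x) (ord_tuple m).
have : j \in sort (nn_le N X' x) (ord_tuple m).
  by rewrite mem_sort val_ord_tuple mem_enum.
case: (sort _ _) => //= j0 s; rewrite inE => /predU1P[->//|js].
move=> /(order_path_min (@nn_le_trans x))/allP/(_ _ js).
by rewrite /nn_le => /orP[/ltW//|/andP[/eqP-> _]].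
Qed.

Context (k : nat) (hk : (1 <= k <= m)%N).

Let k0 : (k%:R : R) != 0.
Proof. by rewrite pnatr_eq0 -lt0n; case/andP: hk. Qed.

Let n0 : (n%:R : R) != 0.
Proof. by rewrite pnatr_eq0 -lt0n. Qed.

Let m0 : (m%:R : R) != 0.
Proof. by rewrite pnatr_eq0 -lt0n. Qed.

Lemma sumr_knn : \sum_(i < n) \sum_(l < m | (l < k)%N) (1 : R) = k%:R * n%:R.
Proof.
case/andP: hk => _ km; under eq_bigr do
  rewrite -(big_ord_widen m (fun=> 1 : R) km) sumr_const card_ord.
by rewrite sumr_const card_ord mulr_natr.
Qed.

(** After exchanging the sums, each pair [(i, l)] selects exactly one index [j], so the total counts
    the [k * n] pairs. *)
Lemma is_weights_knn : is_weights (knn_weights N X' X k).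
Proof.
split=> [j|].
  by rewrite mulr_ge0 ?divr_ge0 ?mulr_ge0//; do 2!apply: sumr_ge0 => ? _.
rewrite -mulr_sumr exchange_big/=.
rewrite [X in _ * X](_ : _ = k%:R * n%:R) ?divfK ?mulf_neq0//.
rewrite -sumr_knn; apply: eq_bigr => i _; rewrite exchange_big/=.
apply: eq_bigr => l _; rewrite (bigD1 (nn_index N X' (X i) l))//= eqxx.
by rewrite big1 ?addr0// => j /negPf->.
Qed.

(** The cost bound is stated for every nonnegative [f], so that a single plan serves all exponents
    [q]. *)
Lemma knn_coupling (hw : is_weights (knn_weights N X' X k)) :
  exists2 gamma : probability (borel_rV R d * borel_rV R d)%type R,
    is_coupling (empirical X hn) (wempirical X' hm hw) gamma &
    forall f : 'rV[R]_d * 'rV[R]_d -> R, (forall z, 0 <= f z) ->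
    (\int[gamma]_z (f z)%:E <= ((k%:R * n%:R)^-1 * \sum_(i < n)
      \sum_(l < m | (l < k)%N) f (X i, nn N X' (X i) l))%:E)%E.
Proof.
(* Atoms are indexed by all pairs of a point and a rank; the restriction to the first [k] ranks is
   moved into the weight, which vanishes beyond them. *)
pose w (p : 'I_n * 'I_m) : R := (p.2 < k)%:R / (k%:R * n%:R).
pose z (p : 'I_n * 'I_m) : borel_rV R d * borel_rV R d :=
  (X p.1, nn N X' (X p.1) p.2).
have w0 p : 0 <= w p by rewrite divr_ge0.
have wE (F : 'I_n * 'I_m -> R) : \sum_p w p * F p =
    (k%:R * n%:R)^-1 * \sum_(i < n) \sum_(l < m | (l < k)%N) F (i, l).
  rewrite mulr_sumr.
  under [RHS]eq_bigr do rewrite mulr_sumr big_mkcond.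
  rewrite pair_bigA; apply: eq_bigr => -[i l] _ /=; rewrite /w/=.
  by case: ifP => _; rewrite ?mul1r ?mul0r.
have w1 : \sum_p w p = 1.
  under eq_bigr do rewrite -[w _]mulr1.
  by rewrite (wE (fun=> 1)) sumr_knn mulVf ?mulf_neq0.
have [gamma gammaE] := @atomic_probability _ _ R ('I_n * 'I_m)%type w w0 z w1.
have gammaF (A : set (borel_rV R d * borel_rV R d)) :
    gamma A = ((k%:R * n%:R)^-1 * \sum_(i < n) \sum_(l < m | (l < k)%N)
      (z (i, l) \in A)%:R)%:E.
  rewrite gammaE -(wE (fun p => (z p \in A)%:R)) -sumEFin.
  by apply: eq_bigr => p _; rewrite diracE -EFinM.
exists gamma => [A mA|f f0]; last first.
  have : (\int[gamma]_z (f z)%:E <= \sum_p (w p)%:E * (f (z p))%:E)%E.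
    apply: (@integral_atoms_le _ (borel_rV R d * borel_rV R d)%type R
      ('I_n * 'I_m)%type w w0 z gamma) => [A _|x]; first exact: gammaE.
    by rewrite lee_fin.
  by under eq_bigr do rewrite -EFinM; rewrite sumEFin (wE (f \o z)).
rewrite !gammaF; split.
  transitivity (empirical_fun X A); last by [].
  rewrite /empirical_fun; under [in RHS]eq_bigr do rewrite diracE.
  rewrite sumEFin -EFinM; congr (_%:E).
  (* The first coordinate of an atom ignores the rank, so each [X i] collects [k] atoms of mass
     [1/(kn)], that is [1/n]. *)
  have fstE i : \sum_(l < m | (l < k)%N) (z (i, l) \in fst @^-1` A)%:R =
      k%:R * (X i \in A)%:R :> R.
    transitivity (\sum_(l < m | (l < k)%N) ((X i \in A)%:R : R)); first by [].
    case/andP: hk => _ km.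
    by rewrite -(big_ord_widen m (fun=> (X i \in A)%:R) km) sumr_const card_ord
      mulr_natl.
  under eq_bigr do rewrite fstE.
  by rewrite -mulr_sumr invfM -mulrA mulrCA mulKf.
transitivity (wempirical_fun (knn_weights N X' X k) X' A); last by [].
rewrite /wempirical_fun; under [in RHS]eq_bigr do rewrite diracE -EFinM.
rewrite sumEFin -EFinM; congr (_%:E).
under [in RHS]eq_bigr do rewrite -mulrA.
rewrite -mulr_sumr -mulrA mulKf//; congr (_ * _).
(* The sum over [j] is brought innermost, where the indicator keeps only the index of the neighbour
   of rank [l]. *)
under [RHS]eq_bigr do rewrite mulr_suml.
rewrite [RHS]exchange_big; apply: eq_bigr => i _ /=.
under [RHS]eq_bigr do rewrite mulr_suml.
rewrite [RHS]exchange_big; apply: eq_bigr => l _ /=.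
rewrite (bigD1 (nn_index N X' (X i) l))//= eqxx mul1r.
by rewrite big1 ?addr0// => j /negPf->; rewrite mul0r.
Qed.

End nearest_neighbors_theory.

Theorem proposition2p2 (R : realType) (d : nat) (N : 'rV[R]_d -> R)
    (hN : is_norm N) (m n : nat) (hm : (0 < m)%N) (hn : (0 < n)%N)
    (X : 'I_n -> 'rV[R]_d) (X' : 'I_m -> 'rV[R]_d) :
  (forall k : nat, (1 <= k <= m)%N ->
    exists hw : is_weights (knn_weights N X' X k),
    forall q : R, 1 <= q ->
      (wasserstein N q (empirical X hn) (wempirical X' hm hw) `^ q <=
       ((k%:R * n%:R)^-1 *
        \sum_(i < n) \sum_(l < m | (l < k)%N)
          N (X i - nn N X' (X i) l) `^ q)%:E)%E)
  /\
  (exists hw1 : is_weights (knn_weights N X' X 1),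
    forall q : R, 1 <= q ->
      (wasserstein N q (empirical X hn) (wempirical X' hm hw1) `^ q =
       (n%:R^-1 *
        \sum_(i < n) N (X i - nn N X' (X i) (Ordinal hm)) `^ q)%:E)%E
      /\
      forall (w : 'I_m -> R) (hw : is_weights w),
        (wasserstein N q (empirical X hn) (wempirical X' hm hw1) <=
         wasserstein N q (empirical X hn) (wempirical X' hm hw))%E).
Proof.
have upper k (hk : (1 <= k <= m)%N) (hw : is_weights (knn_weights N X' X k))
    (q : R) : 1 <= q ->
    (wasserstein N q (empirical X hn) (wempirical X' hm hw) `^ q <=
     ((k%:R * n%:R)^-1 * \sum_(i < n) \sum_(l < m | (l < k)%N)
       N (X i - nn N X' (X i) l) `^ q)%:E)%E.
  move=> q1; rewrite wasserstein_poweR//.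
  have [gamma cpl cost] := knn_coupling N hm hn X X' k hk hw.
  apply: le_trans (cost (fun z => N (z.1 - z.2) `^ q) _); last first.
    by move=> z; exact: powR_ge0.
  by apply: ereal_inf_lbound; exists gamma.
split=> [k hk|].
  by exists (is_weights_knn N hn X X' k hk); exact: upper.
have h1 : (1 <= 1 <= m)%N by [].
exists (is_weights_knn N hn X X' 1 h1) => q q1.
have q0 : 0 <= q by rewrite (le_trans ler01).
(* The left-hand side does not depend on [w]: this one bound gives both the equality for [k = 1] and
   the optimality. *)
have lower (w : 'I_m -> R) (hw : is_weights w) :
    ((n%:R^-1 * \sum_(i < n) N (X i - nn N X' (X i) (Ordinal hm)) `^ q)%:E <=
     ereal_inf [set transport_cost N q gamma | gamma in
       is_coupling (empirical X hn) (wempirical X' hm hw)]%classic)%E.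
  apply: le_ereal_inf_tmp => _ [gamma cpl <-].
  apply: (coupling_integral_ge hn hm X X' w hw gamma _
    (fun x => N (x - nn N X' x (Ordinal hm)) `^ q) cpl).
  - by move=> z; rewrite lee_fin powR_ge0.
  - by move=> x; exact: powR_ge0.
  - move=> i j; rewrite lee_fin ge0_ler_powR ?nnegrE ?is_norm_ge0//.
    exact: nn0_le.
have eq1 : (wasserstein N q (empirical X hn)
      (wempirical X' hm (is_weights_knn N hn X X' 1 h1)) `^ q =
    (n%:R^-1 * \sum_(i < n) N (X i - nn N X' (X i) (Ordinal hm)) `^ q)%:E)%E.
  apply/le_anti/andP; split; last by rewrite wasserstein_poweR.
  apply: le_trans (upper _ h1 _ _ q1) _; rewrite mul1r lee_fin.
  rewrite le_eqVlt; apply/orP; left; apply/eqP; congr (_ * _).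
  (* With [k = 1] the only rank [l < 1] is 0, the nearest neighbour. *)
  apply: eq_bigr => i _; rewrite (big_pred1 (Ordinal hm))// => l.
  by rewrite /= -val_eqE/= ltnS leqn0.
(* By [eq1] the lower bound is the infimum for the 1-NN weights; the power [q^-1] is monotone, which
   passes the comparison of infima to the distances. *)
split=> // w hw; have := lower w hw.
rewrite -eq1 wasserstein_poweR// => le_inf.
rewrite /wasserstein gt0_ler_poweR ?invr_ge0// in_itv/= leey andbT;
  exact: inf_transport_cost_ge0.
Qed.
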